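(* Let $N$ be an s$\ell$-monoid. Then $N$ is commutative, integrally closed and satisfies the square condition if and only if $N$ is isomorphic (as an s$\ell$-monoid) to a nuclear image $M_\gamma$ of some sub-s$\ell$-monoid $M$ of an Abelian lattice-ordered group with respect to some nucleus $\gamma$ on $M$. Likewise, $N$ is commutative, integral and satisfies the square condition if and only if $N$ is isomorphic to a nuclear image of some integral sub-s$\ell$-monoid of an Abelian lattice-ordered group.
   Context: An s$\ell$-monoid is a structure $\langle M,\vee,\cdot,1\rangle$ where $\langle M,\vee\rangle$ is a join semilattice, $\langle M,\cdot,1\rangle$ is a monoid, and $a(b\vee c)=ab\vee ac$, $(a\vee b)c=ac\vee bc$; it is ordered by its semilattice order. It is integral if $1$ is its top element, integrally closed if $ax\leq a$ implies $x\leq 1$ and $xa\leq a$ implies $x\leq 1$. A sub-s$\ell$-monoid of a lattice-ordered group $G$ is a subset containing $1$ and closed under multiplication and binary joins; it is integral if all its elements lie below $1$. A nucleus on an s$\ell$-monoid $M$ is a monotone map $\gamma$ with $a\leq\gamma(a)=\gamma(\gamma(a))$ and $\gamma(a)\gamma(b)\leq\gamma(ab)$; the nuclear image $M_\gamma=\{a:\gamma(a)=a\}$ is an s$\ell$-monoid with order inherited from $M$, joins $\gamma(a\vee b)$, multiplication $\gamma(ab)$ and unit $\gamma(1)$. A commutative s$\ell$-monoid $M$ satisfies the square condition if for all integers $n,k\geq 1$ and every family $(S_{ij})_{1\leq i,j\leq n}$ of subsets of $\{1,\dots,k\}$ such that for each $i$ the sets $S_{i1},\dots,S_{in}$ are pairwise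 disjoint with union $\{1,\dots,k\}$ (empty sets allowed), and for all $x_1,\dots,x_k\in M$, we have $x_1\cdots x_k\leq \bigvee_{j=1}^n \prod_{i=1}^n\prod_{l\in S_{ij}}x_l$ (empty products equal $1$). *)

(* Defs.v *)
From mathcomp Require Import all_boot.
From mathcomp Require Import boolp.

Set Implicit Arguments.
Unset Strict Implicit.
Unset Printing Implicit Defensive.

(* The structures below live on an arbitrary Type: MathComp's monoidType,
   groupType and joinSemilatticeType would add a choice operator and a
   boolean-valued order to the data. *)

Record slMonoid := SlMonoid {
  slm_sort :> Type;
  slm_join : slm_sort -> slm_sort -> slm_sort;
  slm_mul : slm_sort -> slm_sort -> slm_sort;
  slm_one : slm_sort;
  slm_joinA : associative slm_join;
  slm_joinC : commutative slm_join;
  slm_joinxx : idempotent_op slm_join;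
  slm_mulA : associative slm_mul;
  slm_mul1x : left_id slm_one slm_mul;
  slm_mulx1 : right_id slm_one slm_mul;
  slm_mulUr : right_distributive slm_mul slm_join;
  slm_mulUl : left_distributive slm_mul slm_join }.

Arguments slm_one {s}.

Definition slm_le (M : slMonoid) (a b : M) : Prop := slm_join a b = b.

Declare Scope slm_scope.
Delimit Scope slm_scope with slm.
Bind Scope slm_scope with slm_sort.
Local Open Scope slm_scope.

Notation "1" := slm_one : slm_scope.
Notation "a * b" := (slm_mul a b) : slm_scope.
Notation "a `|` b" := (slm_join a b) (at level 52, left associativity)
  : slm_scope.
Notation "a <= b" := (slm_le a b) : slm_scope.

Definition slm_commutative (M : slMonoid) : Prop := commutative (@slm_mul M).

Definition integral (M : slMonoid) : Prop := forall a : M, a <= 1.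

Definition integrally_closed (M : slMonoid) : Prop :=
  (forall a x : M, a * x <= a -> x <= 1) /\
  (forall a x : M, x * a <= a -> x <= 1).

(* A semilattice need not have a bottom, so the join starts from F ord0, which
   by idempotence does not change its value. *)
Definition slm_bigjoin (M : slMonoid) (n : nat) (F : 'I_n.+1 -> M) : M :=
  \big[@slm_join M/F ord0]_(j < n.+1) F j.

(* The integers n, k >= 1 are written n.+1 and k.+1.  On a noncommutative M the
   products are taken in increasing order of the indices. *)
Definition square_condition (M : slMonoid) : Prop :=
  forall (n k : nat) (S : 'I_n.+1 -> 'I_n.+1 -> {set 'I_k.+1}),
    (forall i, (forall j j', j != j' -> [disjoint S i j & S i j']) /\
               \bigcup_(j < n.+1) S i j = [set: 'I_k.+1]) ->
  forall x : 'I_k.+1 -> M,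
    \big[@slm_mul M/1]_(l < k.+1) x l <=
    slm_bigjoin (fun j : 'I_n.+1 =>
      \big[@slm_mul M/1]_(i < n.+1) \big[@slm_mul M/1]_(l in S i j) x l).

Definition slm_iso (M N : slMonoid) : Prop :=
  exists f : M -> N,
    [/\ bijective f,
        {morph f : a b / a `|` b},
        {morph f : a b / a * b} &
        f 1 = 1].

Section OrderFacts.
Variable M : slMonoid.
Implicit Types a b c : M.

Lemma slm_le_refl a : a <= a.
Proof. exact: slm_joinxx. Qed.

Lemma slm_le_trans a b c : a <= b -> b <= c -> a <= c.
Proof. by rewrite /slm_le => ab <-; rewrite slm_joinA ab. Qed.

Lemma slm_le_anti a b : a <= b -> b <= a -> a = b.
Proof. by rewrite /slm_le => ab ba; rewrite -ba slm_joinC. Qed.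

Lemma slm_leUl a b : a <= a `|` b.
Proof. by rewrite /slm_le slm_joinA slm_joinxx. Qed.

Lemma slm_leUr a b : b <= a `|` b.
Proof. by rewrite slm_joinC; exact: slm_leUl. Qed.

Lemma slm_leUP a b c : a <= c -> b <= c -> a `|` b <= c.
Proof. by rewrite /slm_le -slm_joinA => ac ->. Qed.

Lemma slm_leM a b c d : a <= b -> c <= d -> a * c <= b * d.
Proof.
move=> ab cd; apply: (@slm_le_trans _ (b * c)).
  by rewrite /slm_le -slm_mulUl ab.
by rewrite /slm_le -slm_mulUr cd.
Qed.

End OrderFacts.

Record nucleus (M : slMonoid) := Nucleus {
  nuc_fun :> M -> M;
  nuc_mono : forall a b, a <= b -> nuc_fun a <= nuc_fun b;
  nuc_ext : forall a, a <= nuc_fun a;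
  nuc_idem : forall a, nuc_fun (nuc_fun a) = nuc_fun a;
  nuc_mul : forall a b, nuc_fun a * nuc_fun b <= nuc_fun (a * b) }.

Section NuclearImage.
Variables (M : slMonoid) (g : nucleus M).

Definition nuc_sort : Type := {a : M | g a = a}.

Definition nuc_close (a : M) : nuc_sort := exist _ (g a) (nuc_idem g a).

Definition nuc_join (a b : nuc_sort) := nuc_close (sval a `|` sval b).
Definition nuc_mult (a b : nuc_sort) := nuc_close (sval a * sval b).
Definition nuc_one := nuc_close 1.

Lemma nuc_joinl a b : g (g a `|` b) = g (a `|` b).
Proof.
apply: slm_le_anti.
  rewrite -[X in _ <= X]nuc_idem; apply: nuc_mono; apply: slm_leUP.
    by apply: nuc_mono; exact: slm_leUl.
  exact: slm_le_trans (slm_leUr a b) (nuc_ext _ _).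
apply: nuc_mono; apply: slm_leUP; last exact: slm_leUr.
exact: slm_le_trans (nuc_ext g a) (slm_leUl _ _).
Qed.

Lemma nuc_joinr a b : g (a `|` g b) = g (a `|` b).
Proof. by rewrite slm_joinC nuc_joinl slm_joinC. Qed.

Lemma nuc_mull a b : g (g a * b) = g (a * b).
Proof.
apply: slm_le_anti; last first.
  by apply: nuc_mono; apply: slm_leM (slm_le_refl b); exact: nuc_ext.
rewrite -[X in _ <= X]nuc_idem; apply: nuc_mono.
apply: slm_le_trans (nuc_mul _ _ _).
by apply: slm_leM (slm_le_refl _) _; exact: nuc_ext.
Qed.

Lemma nuc_mulr a b : g (a * g b) = g (a * b).
Proof.
apply: slm_le_anti; last first.
  by apply: nuc_mono; apply: slm_leM (slm_le_refl a) _; exact: nuc_ext.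
rewrite -[X in _ <= X]nuc_idem; apply: nuc_mono.
apply: slm_le_trans (nuc_mul _ _ _).
by apply: slm_leM _ (slm_le_refl _); exact: nuc_ext.
Qed.

Fact nuc_joinA : associative nuc_join.
Proof.
by move=> a b c; apply: eq_exist => /=; rewrite nuc_joinl nuc_joinr slm_joinA.
Qed.

Fact nuc_joinC : commutative nuc_join.
Proof. by move=> a b; apply: eq_exist; rewrite slm_joinC. Qed.

Fact nuc_joinxx : idempotent_op nuc_join.
Proof. by case=> a ga; apply: eq_exist; rewrite slm_joinxx. Qed.

Fact nuc_multA : associative nuc_mult.
Proof.
by move=> a b c; apply: eq_exist => /=; rewrite nuc_mull nuc_mulr slm_mulA.
Qed.

Fact nuc_mult1x : left_id nuc_one nuc_mult.
Proof. by case=> a ga; apply: eq_exist; rewrite /= nuc_mull slm_mul1x. Qed.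

Fact nuc_multx1 : right_id nuc_one nuc_mult.
Proof. by case=> a ga; apply: eq_exist; rewrite /= nuc_mulr slm_mulx1. Qed.

Fact nuc_multUr : right_distributive nuc_mult nuc_join.
Proof.
move=> a b c; apply: eq_exist => /=.
by rewrite nuc_mulr nuc_joinl nuc_joinr slm_mulUr.
Qed.

Fact nuc_multUl : left_distributive nuc_mult nuc_join.
Proof.
move=> a b c; apply: eq_exist => /=.
by rewrite nuc_mull nuc_joinl nuc_joinr slm_mulUl.
Qed.

Definition nuclear_image : slMonoid :=
  SlMonoid nuc_joinA nuc_joinC nuc_joinxx
    nuc_multA nuc_mult1x nuc_multx1 nuc_multUr nuc_multUl.

(* The semilattice order of the nuclear image is the order inherited from M. *)
Lemma nuclear_image_le (a b : nuclear_image) : a <= b <-> sval a <= sval b.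
Proof.
split=> [ab|ab].
  apply: slm_le_trans (slm_leUl _ (sval b)) _.
  by rewrite -[X in _ <= X](congr1 sval ab) /=; exact: nuc_ext.
case: a b ab => a ga [b gb] /= ab.
by apply: eq_exist => /=; rewrite ab.
Qed.

End NuclearImage.

Record lGroup := LGroup {
  lg_sort :> Type;
  lg_join : lg_sort -> lg_sort -> lg_sort;
  lg_meet : lg_sort -> lg_sort -> lg_sort;
  lg_mul : lg_sort -> lg_sort -> lg_sort;
  lg_one : lg_sort;
  lg_inv : lg_sort -> lg_sort;
  lg_joinA : associative lg_join;
  lg_joinC : commutative lg_join;
  lg_meetA : associative lg_meet;
  lg_meetC : commutative lg_meet;
  lg_joinKI : forall a b, lg_meet a (lg_join a b) = a;
  lg_meetKU : forall a b, lg_join a (lg_meet a b) = a;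
  lg_mulA : associative lg_mul;
  lg_mul1x : left_id lg_one lg_mul;
  lg_mulx1 : right_id lg_one lg_mul;
  lg_mulVx : left_inverse lg_one lg_inv lg_mul;
  lg_mulxV : right_inverse lg_one lg_inv lg_mul;
  (* translations are monotone, where a <= b stands for lg_join a b = b *)
  lg_leM2l : forall c a b, lg_join a b = b ->
    lg_join (lg_mul c a) (lg_mul c b) = lg_mul c b;
  lg_leM2r : forall c a b, lg_join a b = b ->
    lg_join (lg_mul a c) (lg_mul b c) = lg_mul b c }.

Definition lg_abelian (G : lGroup) : Prop := commutative (@lg_mul G).

Section LGroupSlMonoid.
Variable G : lGroup.
Local Notation join := (@lg_join G).
Local Notation mul := (@lg_mul G).
Local Notation inv := (@lg_inv G).
Local Notation le a b := (join a b = b).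

Fact lg_joinxx : idempotent_op join.
Proof. by move=> a; rewrite -{2}(lg_joinKI a a) lg_meetKU. Qed.

Let le_anti a b : le a b -> le b a -> a = b.
Proof. by move=> ab ba; rewrite -ba lg_joinC. Qed.

Let leUP a b c : le a c -> le b c -> le (join a b) c.
Proof. by move=> ac bc; rewrite -lg_joinA bc. Qed.

Let leUl a b : le a (join a b).
Proof. by rewrite lg_joinA lg_joinxx. Qed.

Let leUr a b : le b (join a b).
Proof. by rewrite lg_joinC -lg_joinA lg_joinxx. Qed.

Fact lg_mulUr : right_distributive mul join.
Proof.
move=> c a b; apply: le_anti; last first.
  by apply: leUP; apply: lg_leM2l; [exact: leUl|exact: leUr].
set d := join (mul c a) _.
have K x : mul (inv c) (mul c x) = x by rewrite lg_mulA lg_mulVx lg_mul1x.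
have -> : d = mul c (mul (inv c) d) by rewrite lg_mulA lg_mulxV lg_mul1x.
apply: lg_leM2l; apply: leUP.
  by rewrite -{1}(K a); apply: lg_leM2l; exact: leUl.
by rewrite -{1}(K b); apply: lg_leM2l; exact: leUr.
Qed.

Fact lg_mulUl : left_distributive mul join.
Proof.
move=> a b c; apply: le_anti; last first.
  by apply: leUP; apply: lg_leM2r; [exact: leUl|exact: leUr].
set d := join (mul a c) _.
have K x : mul (mul x c) (inv c) = x by rewrite -lg_mulA lg_mulxV lg_mulx1.
have -> : d = mul (mul d (inv c)) c by rewrite -lg_mulA lg_mulVx lg_mulx1.
apply: lg_leM2r; apply: leUP.
  by rewrite -{1}(K a); apply: lg_leM2r; exact: leUl.
by rewrite -{1}(K b); apply: lg_leM2r; exact: leUr.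
Qed.

Definition lg_slMonoid : slMonoid :=
  SlMonoid (@lg_joinA G) (@lg_joinC G) lg_joinxx
    (@lg_mulA G) (@lg_mul1x G) (@lg_mulx1 G) lg_mulUr lg_mulUl.

End LGroupSlMonoid.

Record subSlMonoid (G : lGroup) := SubSlMonoid {
  sub_pred :> lg_slMonoid G -> Prop;
  sub_one : sub_pred 1;
  sub_mul : forall a b, sub_pred a -> sub_pred b -> sub_pred (a * b);
  sub_join : forall a b, sub_pred a -> sub_pred b -> sub_pred (a `|` b) }.

Definition sub_integral (G : lGroup) (M : subSlMonoid G) : Prop :=
  forall a : lg_slMonoid G, M a -> a <= 1.

Section SubSlMonoidStructure.
Variables (G : lGroup) (M : subSlMonoid G).

Definition sub_sort : Type := {a : lg_slMonoid G | M a}.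

Definition subs_join (a b : sub_sort) : sub_sort :=
  exist _ (sval a `|` sval b) (sub_join (svalP a) (svalP b)).
Definition subs_mul (a b : sub_sort) : sub_sort :=
  exist _ (sval a * sval b) (sub_mul (svalP a) (svalP b)).
Definition subs_one : sub_sort := exist _ 1 (sub_one M).

Fact subs_joinA : associative subs_join.
Proof. by move=> a b c; apply: eq_exist; exact: slm_joinA. Qed.

Fact subs_joinC : commutative subs_join.
Proof. by move=> a b; apply: eq_exist; exact: slm_joinC. Qed.

Fact subs_joinxx : idempotent_op subs_join.
Proof. by case=> a Ma; apply: eq_exist; exact: slm_joinxx. Qed.

Fact subs_mulA : associative subs_mul.
Proof. by move=> a b c; apply: eq_exist; exact: slm_mulA. Qed.

Fact subs_mul1x : left_id subs_one subs_mul.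
Proof. by case=> a Ma; apply: eq_exist; exact: slm_mul1x. Qed.

Fact subs_mulx1 : right_id subs_one subs_mul.
Proof. by case=> a Ma; apply: eq_exist; exact: slm_mulx1. Qed.

Fact subs_mulUr : right_distributive subs_mul subs_join.
Proof. by move=> a b c; apply: eq_exist; exact: slm_mulUr. Qed.

Fact subs_mulUl : left_distributive subs_mul subs_join.
Proof. by move=> a b c; apply: eq_exist; exact: slm_mulUl. Qed.

Definition sub_slMonoid : slMonoid :=
  SlMonoid subs_joinA subs_joinC subs_joinxx
    subs_mulA subs_mul1x subs_mulx1 subs_mulUr subs_mulUl.

End SubSlMonoidStructure.

(* Main.v *)
Require Import Defs.
From HB Require Import structures.
From mathcomp Require Import all_boot ssralg ssrint zify.
From mathcomp Require Import boolp classical_sets functions.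

(** Necessity: in an abelian l-group the columns of a square multiply to the
    n-th power of x_1 ... x_k, and a^n <= b^n implies a <= b; nuclear images
    inherit the square condition.

    Sufficiency: in the free abelian group on the set N take the cone generated
    by all [v] - [u_1] - ... - [u_p] with u_1 ... u_p <= v in N, and let G be the
    product of the totally ordered quotients of that group by all total cones
    extending it. M consists of the finite nonempty joins in G of sums of
    generators. Evaluation of such joins in N is well defined on M, and [_] is
    its right adjoint, which gives the nucleus. Well-definedness is the point: by
    Zorn's lemma, if m <= m_1 \/ ... \/ m_r in G, then a sum of n of the m_j,
    with repetitions, is n m plus an element of the cone. The generators of the
    cone occurring there can be eliminated one at a time, using integral
    closedness, and what remains is an instance of the square condition. *)

Set Implicit Arguments.
Unset Strict Implicit.
Unset Printing Implicit Defensive.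

(** * Necessity *)

Section CommutativeLaw.
Variables (M : slMonoid) (mulC : slm_commutative M).

(** Packs the multiplication as a commutative law from the hypothesis [mulC], so that the big
    operator lemmas apply. *)
Definition slm_com_law : Monoid.com_law (@slm_one M) :=
  HB.pack_for (Monoid.com_law (@slm_one M)) (@slm_mul M)
    (Monoid.isComLaw.Build M slm_one (@slm_mul M)
      (@slm_mulA M) mulC (@slm_mul1x M)).

End CommutativeLaw.

Local Open Scope slm_scope.

Lemma le_slm_bigjoin (M : slMonoid) (n : nat) (F : 'I_n.+1 -> M) (j : 'I_n.+1) :
  F j <= slm_bigjoin F.
Proof.
rewrite /slm_bigjoin; move: (F ord0) (mem_index_enum j) => x0.
elim: (index_enum _) => // i s IHs; rewrite in_cons big_cons.
case/predU1P=> [->|/IHs js]; first exact: slm_leUl.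
exact: slm_le_trans js (slm_leUr _ _).
Qed.

Lemma slm_bigjoin_le (M : slMonoid) (n : nat) (F : 'I_n.+1 -> M) (c : M) :
  (forall j, F j <= c) -> slm_bigjoin F <= c.
Proof.
by move=> Fc; apply: (big_ind (fun a => a <= c)) => // a b; exact: slm_leUP.
Qed.

(** * Cancellation of powers and the square condition *)

Section PowerCancellation.
Variables (M : slMonoid) (mulC : slm_commutative M).
Hypothesis lecancel : forall a b c : M, a * c <= b * c -> a <= b.
Local Notation pw a n := (iter n (slm_mul a) 1).

(** In the expansion of the left side every term other than the power of [a] has a factor [b], and
    its other factors lie below the join of [a] and [b]. *)
Lemma pow_join_le (a b : M) (n : nat) :
  pw (a `|` b) n.+1 <= pw a n.+1 `|` b * pw (a `|` b) n.
Proof.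
elim: n => [|n IHn]; first by rewrite /= !slm_mulx1; exact: slm_le_refl.
rewrite [pw (a `|` b) n.+2]iterS; set J := pw (a `|` b) n.+1 in IHn *.
rewrite slm_mulUl; apply: slm_leUP; last exact: slm_leUr.
apply: slm_le_trans (slm_leM (slm_le_refl a) IHn) _.
rewrite slm_mulUr; apply: slm_leUP; first exact: slm_leUl.
rewrite slm_mulA (mulC a) -slm_mulA; apply: slm_le_trans (slm_leUr _ _).
apply: slm_leM (slm_le_refl _) _; rewrite /J iterS.
exact: slm_leM (slm_leUl _ _) (slm_le_refl _).
Qed.

(** Let J be the join of a and b. Since a^(n+1) <= b^(n+1) <= b J^n, [pow_join_le] gives J^(n+1) <=
    b J^n, and cancelling J^n leaves J <= b. *)
Lemma pow_le_cancel (a b : M) (n : nat) : pw a n.+1 <= pw b n.+1 -> a <= b.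
Proof.
move=> ab; apply: slm_le_trans (slm_leUl a b) _.
apply: (lecancel (c := pw (a `|` b) n)).
apply: slm_le_trans (pow_join_le a b n) _.
apply: slm_leUP (slm_le_refl _); apply: slm_le_trans ab _.
apply: slm_leM (slm_le_refl b) _.
elim: n => [|n IHn] /=; first exact: slm_le_refl.
exact: slm_leM (slm_leUr _ _) IHn.
Qed.

(* Multiplied together, the columns of the square give the n-th power of the
   product of the x_l, so their join cannot be smaller than that product. *)
Lemma square_condition_of_lecancel : square_condition M.
Proof.
move=> n k S Spart x; set J := slm_bigjoin _; apply: (@pow_le_cancel _ _ n).
have -> : pw J n.+1 = \big[@slm_mul M/1]_(j < n.+1) J.
  by rewrite big_const_ord.
pose y j := \big[@slm_mul M/1]_(i < n.+1) \big[@slm_mul M/1]_(l in S i j) x l.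
apply: (@slm_le_trans _ _ (\big[@slm_mul M/1]_(j < n.+1) y j)); last first.
  apply: (big_ind2 (fun a b : M => a <= b)).
  - exact: slm_le_refl.
  - by move=> *; exact: slm_leM.
  - by move=> j _; exact: (@le_slm_bigjoin _ _ y j).
have -> : \big[@slm_mul M/1]_(j < n.+1) y j =
          \big[@slm_mul M/1]_(i < n.+1) \big[@slm_mul M/1]_(l < k.+1) x l.
  rewrite /y (@exchange_big _ _ (slm_com_law mulC)) /=; apply: eq_bigr => i _.
  have [Sdisj Scover] := Spart i.
  rewrite -(partition_disjoint_bigcup (slm_com_law mulC) _ Sdisj) /= Scover.
  by apply: eq_bigl => l; rewrite inE.
by rewrite big_const_ord; exact: slm_le_refl.
Qed.

End PowerCancellation.

(** * Transfer of laws along a relation *)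

Section Transfer.
Variables (X Y : slMonoid) (K : X -> Y -> Prop) (h : X -> Y).
Hypotheses (Kh : forall x, K x (h x)) (K1 : K 1 1).
Hypothesis KM : forall x y x' y', K x y -> K x' y' -> K (x * x') (y * y').
Hypothesis KU : forall x y x' y', K x y -> K x' y' -> K (x `|` x') (y `|` y').
Hypothesis Kle : forall x y x' y', K x y -> K x' y' -> y <= y' -> x <= x'.

(** Compatibility of [K] with 1, products and joins relates both sides of an instance in X to those
    of its image under [h]; [Kle] then reflects the inequality. *)
Lemma square_condition_transfer : square_condition Y -> square_condition X.
Proof.
move=> sqY n k S Spart x; apply: Kle (sqY n k S Spart (h \o x)).
  by apply: big_ind2 => // l _; exact: Kh.
have Kcol j :
  K (\big[@slm_mul X/1]_(i < n.+1) \big[@slm_mul X/1]_(l in S i j) x l)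
    (\big[@slm_mul Y/1]_(i < n.+1) \big[@slm_mul Y/1]_(l in S i j) h (x l)).
  by apply: big_ind2 => // i _; apply: big_ind2 => // l _; exact: Kh.
by apply: big_ind2 => // [|j _]; exact: Kcol.
Qed.

Lemma commutative_transfer : slm_commutative Y -> slm_commutative X.
Proof.
move=> mulC x x'; apply: slm_le_anti.
  apply: Kle (KM (Kh x) (Kh x')) (KM (Kh x') (Kh x)) _.
  by rewrite mulC; exact: slm_le_refl.
apply: Kle (KM (Kh x') (Kh x)) (KM (Kh x) (Kh x')) _.
by rewrite mulC; exact: slm_le_refl.
Qed.

End Transfer.

(** * Nuclear images of submonoids of l-groups *)

Section SubmonoidOfLGroup.
Variables (G : lGroup) (M : subSlMonoid G).

Lemma sub_slMonoid_le (a b : sub_slMonoid M) :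
  a <= b <-> (sval a : lg_slMonoid G) <= sval b.
Proof.
split=> [ab|]; first exact: (congr1 sval ab).
by case: a b => a Ma [b Mb] ab; apply: eq_exist.
Qed.

Lemma lg_lecancelr (a b c : lg_slMonoid G) : a * c <= b * c -> a <= b.
Proof.
move=> acbc; have := slm_leM acbc (slm_le_refl (lg_inv c : lg_slMonoid G)).
by rewrite -!slm_mulA (lg_mulxV c : c * lg_inv c = 1) !slm_mulx1.
Qed.

Lemma lg_lecancell (a b c : lg_slMonoid G) : c * a <= c * b -> a <= b.
Proof.
move=> cacb; have := slm_leM (slm_le_refl (lg_inv c : lg_slMonoid G)) cacb.
by rewrite !slm_mulA (lg_mulVx c : (lg_inv c : lg_slMonoid G) * c = 1) !slm_mul1x.
Qed.

Lemma sub_slMonoid_lecancelr (a b c : sub_slMonoid M) :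
  a * c <= b * c -> a <= b.
Proof. by move=> /sub_slMonoid_le /lg_lecancelr /sub_slMonoid_le. Qed.

Lemma sub_slMonoid_lecancell (a b c : sub_slMonoid M) :
  c * a <= c * b -> a <= b.
Proof. by move=> /sub_slMonoid_le /lg_lecancell /sub_slMonoid_le. Qed.

Variables (N : slMonoid) (g : nucleus (sub_slMonoid M)).
Variable f : N -> nuclear_image g.
Hypotheses (fbij : bijective f) (fU : {morph f : a b / a `|` b}).
Hypotheses (fM : {morph f : a b / a * b}) (f1 : f 1 = 1).

Let lef (a b : N) : a <= b <-> sval (f a) <= sval (f b).
Proof.
split=> [ab|/nuclear_image_le].
  by apply/nuclear_image_le; rewrite /slm_le -fU ab.
by rewrite /slm_le -fU; exact: bij_inj.
Qed.

(** The representative [y] need not be a fixed point of [g], so products and joins of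
    representatives can be formed in M itself. *)
Let K (a : N) (y : sub_slMonoid M) := sval (f a) = g y.

Let Kh a : K a (sval (f a)).
Proof. by rewrite /K (svalP (f a)). Qed.

Let K1 : K 1 1. Proof. by rewrite /K f1. Qed.

Let KM a y b z : K a y -> K b z -> K (a * b) (y * z).
Proof. by rewrite /K fM /= => -> ->; rewrite nuc_mull nuc_mulr. Qed.

Let KU a y b z : K a y -> K b z -> K (a `|` b) (y `|` z).
Proof. by rewrite /K fU /= => -> ->; rewrite nuc_joinl nuc_joinr. Qed.

Let Kle a y b z : K a y -> K b z -> y <= z -> a <= b.
Proof. by rewrite /K lef => -> ->; exact: nuc_mono. Qed.

Lemma nuclear_image_commutative_square :
  lg_abelian G -> slm_commutative N /\ square_condition N.
Proof.
move=> abG.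
have mulC : slm_commutative (sub_slMonoid M).
  by move=> a b; apply: eq_exist; exact: abG.
split; first exact: commutative_transfer Kh KM Kle mulC.
apply: (square_condition_transfer Kh K1 KM KU Kle).
exact: square_condition_of_lecancel mulC sub_slMonoid_lecancelr.
Qed.

Let le1f (a : N) : sval (f a) <= 1 -> a <= 1.
Proof. by move=> fa; apply: (Kle (Kh a) K1). Qed.

(** The image of a product lies above the product in M of the images, so [a * x <= a] becomes an
    inequality in M, where the image of [a] cancels. *)
Lemma nuclear_image_integrally_closed : integrally_closed N.
Proof.
split=> a x /lef axa; apply: le1f.
  apply: (@sub_slMonoid_lecancell _ _ (sval (f a))); rewrite slm_mulx1.
  by apply: slm_le_trans axa; rewrite fM; exact: nuc_ext.
apply: (@sub_slMonoid_lecancelr _ _ (sval (f a))); rewrite slm_mul1x.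
by apply: slm_le_trans axa; rewrite fM; exact: nuc_ext.
Qed.

Lemma nuclear_image_integral : sub_integral M -> integral N.
Proof.
by move=> M1 a; apply/le1f/sub_slMonoid_le; exact: M1 (svalP (sval (f a))).
Qed.

End SubmonoidOfLGroup.

(** * Comparing products in [N] *)

(** With [h] a projection, labels attached to letters are carried along a permutation of the
    letters. *)
Lemma perm_map_lift (A B : eqType) (h : A -> B) (s : seq A) (w : seq B) :
  perm_eq (map h s) w -> exists2 s', perm_eq s s' & map h s' = w.
Proof.
elim: w s => [|b w IHw] s hs; first by exists s => //; exact/perm_nilP.
have /mapP[a sa eb] : b \in map h s by rewrite (perm_mem hs) mem_head.
have ps := perm_to_rem sa.
have [|s' ss' hs'] := IHw (rem a s).
  by rewrite -(perm_cons b) -(permPr hs) {1}eb -map_cons perm_sym perm_map.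
by exists (a :: s'); [rewrite (permPl ps) perm_cons|rewrite /= hs' -eb].
Qed.

Section Products.
Variables (N : slMonoid) (mulC : slm_commutative N).
Variables (T : eqType) (ev : T -> N).
Let mul := slm_com_law mulC.

(** Letters come from an [eqType], as [perm_eq] and [rem] require, and are evaluated in N by
    [ev]. *)
Definition evs (s : seq T) : N := \big[@slm_mul N/1]_(a <- s) ev a.

Lemma evs_nil : evs [::] = 1.
Proof. by rewrite /evs big_nil. Qed.

Lemma evs1 (a : T) : evs [:: a] = ev a.
Proof. by rewrite /evs big_cons big_nil slm_mulx1. Qed.

Lemma evs_cat (s t : seq T) : evs (s ++ t) = evs s * evs t.
Proof. exact: (big_cat mul). Qed.

Lemma evs_perm (s t : seq T) : perm_eq s t -> evs s = evs t.
Proof. by move=> st; exact: (perm_big (op := mul) _ st). Qed.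

Hypothesis sqN : square_condition N.

(* The permutation labels each letter of each copy of m with the word of Ms it
   goes to; S i j collects the letters of the i-th copy with label j. *)
Lemma evs_le_of_perm (Ms : seq (seq T)) (m : seq T) (c : N) :
  (0 < size Ms)%N -> perm_eq (flatten Ms) (flatten (nseq (size Ms) m)) ->
  (forall s, s \in Ms -> evs s <= c) -> evs m <= c.
Proof.
(* The square condition speaks of at least one letter. If [m] is empty, counting letters shows that
   the words of [Ms] are empty too. *)
case: m => [|a0 m'] Ms0 pMs Mc.
  case: Ms Ms0 pMs Mc => // s Ms _ pMs /(_ s (mem_head _ _)).
  suff -> : s = [::] by [].
  have := perm_size pMs; rewrite !size_flatten /shape map_nseq sumn_nseq mul0n.
  by case: s {pMs}.
case: Ms => // s0 Ms' in Ms0 pMs Mc *.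
set Ms := s0 :: Ms' in Ms0 pMs Mc *; pose n := size Ms'.
set m := a0 :: m' in pMs *; pose k := size m'.
pose Z := flatten
  [seq [seq (a, j) | a <- nth [::] Ms j] | j : 'I_n.+1 <- enum 'I_n.+1].
have Z1 : map fst Z = flatten Ms.
  rewrite map_flatten -map_comp; congr flatten.
  rewrite -[RHS](mkseq_nth [::]) /mkseq -val_enum_ord -map_comp.
  by apply: eq_map => j /=; rewrite -map_comp map_id.
have [Z' pZ Z'1] : exists2 Z', perm_eq Z Z' & map fst Z' = flatten (nseq n.+1 m).
  by apply: perm_map_lift; rewrite Z1.
(* Cut into blocks of the length of [m], the permuted list becomes n.+1 labelled copies of [m], the
   rows of the square. *)
pose R := reshape (nseq n.+1 k.+1) Z'.
have shm : shape (nseq n.+1 m) = nseq n.+1 k.+1 by rewrite /shape map_nseq.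
have szZ' : size Z' = sumn (nseq n.+1 k.+1).
  by rewrite -(size_map fst) Z'1 size_flatten shm.
have RZ' : flatten R = Z' by rewrite reshapeKr ?szZ'.
have R1 : map (map fst) R = nseq n.+1 m by rewrite map_reshape Z'1 -shm flattenK.
have szR : size R = n.+1 by rewrite -(size_map (map fst)) R1 size_nseq.
have row1 (i : 'I_n.+1) : map fst (nth [::] R i) = m.
  by rewrite -(nth_map [::] [::]) ?szR // R1 nth_nseq ltn_ord.
have szrow (i : 'I_n.+1) : size (nth [::] R i) = k.+1.
  by rewrite -(size_map fst) row1.
pose z0 : T * 'I_n.+1 := (a0, ord0).
pose S (i j : 'I_n.+1) := [set l : 'I_k.+1 | (nth z0 (nth [::] R i) l).2 == j].
have Spart i : (forall j j', j != j' -> [disjoint S i j & S i j']) /\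
    \bigcup_(j < n.+1) S i j = [set: 'I_k.+1].
  split=> [j j' jj'|]; last first.
    apply/setP=> l; rewrite inE; apply/bigcupP.
    by exists (nth z0 (nth [::] R i) l).2; rewrite ?inE.
  rewrite -setI_eq0; apply/eqP/setP => l; rewrite !inE.
  by apply/negP => /andP[/eqP-> /eqP ejj']; rewrite ejj' eqxx in jj'.
have := sqN Spart (fun l => ev (nth a0 m l)).
have -> : \big[@slm_mul N/1]_(l < k.+1) ev (nth a0 m l) = evs m.
  by rewrite /evs (big_nth a0) big_mkord.
move/slm_le_trans; apply; apply: slm_bigjoin_le => j.
suff -> : \big[@slm_mul N/1]_(i < n.+1) \big[@slm_mul N/1]_(l in S i j)
   ev (nth a0 m l) = evs (nth [::] Ms j) by apply/Mc/mem_nth.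
(* Column j collects the letters labelled j from all rows. Over [Z], a rearrangement of the
   concatenated rows, these are exactly the letters of the j-th word. *)
transitivity (\big[mul/1]_(i < n.+1) \big[mul/1]_(z <- nth [::] R i | z.2 == j)
   ev z.1).
  apply: eq_bigr => i _; rewrite (big_nth z0) szrow big_mkord.
  by apply: eq_big => l; rewrite ?inE // -(row1 i) (nth_map z0) ?szrow.
transitivity (\big[mul/1]_(r <- R) \big[mul/1]_(z <- r | z.2 == j) ev z.1).
  by rewrite [RHS](big_nth [::]) szR big_mkord.
rewrite -big_flatten RZ' -(perm_big _ pZ) /Z big_flatten big_map big_enum.
transitivity (mul (evs (nth [::] Ms j)) 1); last exact: slm_mulx1.
rewrite (bigD1 j) //; congr (mul _ _).
  by rewrite big_map /evs; apply: eq_bigl => a; rewrite eqxx.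
apply: big1 => i ij; rewrite big_map; apply: big1 => a aij.
by rewrite [i == j]aij in ij.
Qed.

Hypothesis icN : integrally_closed N.

Lemma evs_rem (v : T) (s : seq T) : v \in s -> evs s = ev v * evs (rem v s).
Proof. by move=> /perm_to_rem/evs_perm->; rewrite -cat1s evs_cat evs1. Qed.

(* Each relation u <= v is removed by substituting u for the occurrence of v it
   is matched with on the left; when that occurrence lies in u itself, the rest
   of u is below 1 by integral closedness and can be added to any word. *)
Lemma evs_le_of_relations (R : seq (seq T * T)) (Ms : seq (seq T)) (m : seq T)
    (c : N) :
  (0 < size Ms)%N -> (forall r, r \in R -> evs r.1 <= ev r.2) ->
  perm_eq (flatten Ms ++ flatten (unzip1 R))
          (flatten (nseq (size Ms) m) ++ unzip2 R) ->
  (forall s, s \in Ms -> evs s <= c) -> evs m <= c.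
Proof.
have [k] := ubnP (size R); elim: k R Ms => // k IHk [|[u v] R] Ms szR Ms0 Rle.
  by rewrite !cats0; exact: evs_le_of_perm.
move=> pMs Mc.
have uv : evs u <= ev v by apply: (Rle (u, v)); exact: mem_head.
have {}Rle r : r \in R -> evs r.1 <= ev r.2.
  by move=> rR; apply: Rle; rewrite in_cons rR orbT.
have : v \in flatten Ms ++ flatten (unzip1 ((u, v) :: R)).
  by rewrite (perm_mem pMs) mem_cat /= mem_head orbT.
rewrite /= !mem_cat.
case/or3P=> [/flattenP[s sMs vs]|vu|/flattenP[_ /mapP[[w z] wR ->] /= vw]].
- case/splitPr: sMs => A B in Ms0 Mc pMs *.
  apply: (IHk R (A ++ (u ++ rem v s) :: B)) => //.
  + by rewrite size_cat /= addnS.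
  + apply/permP=> p; move/permP/(_ p): pMs; move/permP/(_ p): (perm_to_rem vs).
    rewrite !size_cat /= !flatten_cat /= !count_cat /= ?count_cat; lia.
  + move=> t; rewrite mem_cat in_cons => /or3P[tA|/eqP->|tB].
    * by apply: Mc; rewrite mem_cat tA.
    * apply: slm_le_trans (Mc s _); last by rewrite mem_cat mem_head orbT.
      rewrite evs_cat (evs_rem vs).
      exact: slm_leM uv (slm_le_refl _).
    * by apply: Mc; rewrite mem_cat in_cons tB !orbT.
(* Here [v] occurs in its own [u]; the rest of [u] is appended to the first word, which exists
   because [Ms] is nonempty. *)
- case: Ms => // s Ms in Ms0 Mc pMs *.
  apply: (IHk R ((s ++ rem v u) :: Ms)) => //.
    apply/permP=> p; move/permP/(_ p): pMs; move/permP/(_ p): (perm_to_rem vu).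
    by rewrite /= !count_cat /= ?count_cat; lia.
  move=> t; rewrite in_cons => /predU1P[->|tMs]; last first.
    by apply: Mc; rewrite in_cons tMs orbT.
  apply: slm_le_trans (Mc s (mem_head _ _)).
  rewrite evs_cat -[X in _ <= X]slm_mulx1; apply: slm_leM (slm_le_refl _) _.
  by apply: (icN.1 (ev v)); rewrite -evs_rem.
(* Here another relation w <= z uses [v]; substitution merges the two relations into one. *)
- case/splitPr: wR => A B in szR Rle pMs *.
  apply: (IHk (A ++ (u ++ rem v w, z) :: B) Ms) => //.
  + by move: szR; rewrite /= !size_cat /=; lia.
  + move=> t; rewrite mem_cat in_cons => /or3P[tA|/eqP->|tB] /=.
    * by apply: Rle; rewrite mem_cat tA.
    * apply: slm_le_trans (Rle (w, z) _); last by rewrite mem_cat mem_head orbT.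
      rewrite evs_cat (evs_rem vw).
      exact: slm_leM uv (slm_le_refl _).
    * by apply: Rle; rewrite mem_cat in_cons tB !orbT.
  + apply/permP=> p; move/permP/(_ p): pMs; move/permP/(_ p): (perm_to_rem vw).
    rewrite /= /unzip1 /unzip2 !map_cat /= !flatten_cat /= !count_cat /=.
    rewrite ?count_cat /=.
    lia.
Qed.

End Products.

(** * Total cones of an abelian group *)

Import GRing.Theory.

(** The nonnegative elements of a translation-invariant total preorder: [x] and [- x] may both
    belong, and the group is totally ordered modulo such elements. *)
Definition total_cone (H : zmodType) (T : set H) : Prop :=
  [/\ T 0%R, forall x y, T x -> T y -> T (x + y)%R & forall x, T x \/ T (- x)%R].

Section TotalConeExtension.
Local Open Scope ring_scope.
Local Open Scope classical_set_scope.
Variables (H : zmodType) (C B : set H).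
Hypotheses (C0 : C 0) (CD : forall x y, C x -> C y -> C (x + y)).
Hypotheses (BD : forall x y, B x -> B y -> B (x + y)).
Hypothesis CB : forall x, C x -> ~ B x.

Let good (D : set H) :=
  [/\ C `<=` D, forall x y, D x -> D y -> D (x + y) & forall x, D x -> ~ B x].

Let adjoin (D : set H) (h : H) := [set x | exists a n, D a /\ x = a + h *+ n].

Let maximal_good :
  exists2 D, good D & forall h, ~ D h -> exists2 x, adjoin D h x & B x.
Proof.
have [F FP totF|A [PA Amax]] := @Zorn_bigcup H [set D | D = set0 \/ good D].
  have [[X FX X0]|noX] := pselect (exists2 X, F X & X !=set0); last first.
    left; rewrite -subset0 => x [X FX Xx]; apply: noX.
    by exists X => //; exists x.
  have goodF Y : F Y -> Y !=set0 -> good Y.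
    by move=> /FP[->|//] /set0P; rewrite eqxx.
  right; split=> [x Cx|x y [Y FY Yx] [Z FZ Zy]|x [Y FY Yx]].
  - by exists X => //; case: (goodF X FX X0) => + _ _; apply.
  - have [YZ|ZY] := totF _ _ FY FZ.
      exists Z => //; case: (goodF Z FZ) => [|_ ZD _]; first by exists y.
      by apply: ZD => //; exact: YZ.
    exists Y => //; case: (goodF Y FY) => [|_ YD _]; first by exists x.
    by apply: YD => //; exact: ZY.
  - by case: (goodF Y FY) => [|_ _]; [exists x|apply].
have gA : good A.
  case: PA => // A0; case: (Amax C); last by right; split.
  by rewrite A0; split=> // /(_ 0 C0).
exists A => // h Ah; have [CA AD AB] := gA; have A0 := CA _ C0.
apply: contrapT => noB; case: (Amax (adjoin A h)).
  split=> [x Ax|/(_ h) sub]; first by exists x, 0%N; rewrite mulr0n addr0.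
  by apply/Ah/sub; exists 0, 1%N; rewrite add0r.
right; split=> [x Cx|_ _ [a [n [Aa ->]]] [b [p [Ab ->]]]|x Dx Bx].
- by exists x, 0%N; split; [exact: CA|rewrite mulr0n addr0].
- by exists (a + b), (n + p)%N; split; [exact: AD|rewrite mulrnDr addrACA].
- by apply: noB; exists x.
Qed.

(** If a maximal good T misses h and -h, then a + n h and b - p h lie in B for some a, b in T. If n
    or p is 0, then a or b lies in both T and B. Otherwise p (a + n h) + n (b - p h) = p a + n b
    does. *)
Lemma total_cone_extension :
  exists T, [/\ total_cone T, C `<=` T & forall x, T x -> ~ B x].
Proof.
have [T [CT TD TB] Tmax] := maximal_good.
have T0 := CT _ C0; exists T; split=> //; split=> // h.
apply: contrapT => /not_orP[/Tmax[_ [a [n [Ta ->]]] Bn]].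
move=> /Tmax[_ [b [p [Tb ->]]] Bp].
have Bmul x k : B x -> B (x *+ k.+1).
  by move=> Bx; elim: k => // k IHk; rewrite mulrS; exact: BD.
have Tmul x k : T x -> T (x *+ k).
  by move=> Tx; elim: k => // k IHk; rewrite mulrS; exact: TD.
case: n Bn => [|n] Bn; first by apply: TB Ta _; rewrite mulr0n addr0 in Bn.
case: p Bp => [|p] Bp; first by apply: TB Tb _; rewrite mulr0n addr0 in Bp.
have := BD (Bmul _ p Bn) (Bmul _ n Bp); apply: TB.
rewrite !mulrnDl addrACA !mulNrn -!mulrnA [(p.+1 * _)%N]mulnC addrN addr0.
by apply: TD; exact: Tmul.
Qed.

End TotalConeExtension.

(** * The l-group of a lattice-preordered abelian group *)

Section LatticePreorderedGroup.
Local Open Scope ring_scope.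
Variables (X : zmodType) (le : X -> X -> Prop) (join : X -> X -> X).
Hypotheses (lexx : forall x, le x x).
Hypotheses (le_trans : forall y x z, le x y -> le y z -> le x z).
Hypotheses (leD2 : forall z x y, le x y -> le (x + z) (y + z)).
Hypotheses (leUl : forall x y, le x (join x y)).
Hypotheses (leUr : forall x y, le y (join x y)).
Hypotheses (leUP : forall x y z, le x z -> le y z -> le (join x y) z).

Let equiv x y := le x y /\ le y x.

(** A chosen element of the class of [x]. As [xget] depends only on the set, the quotient can be
    encoded as the fixed points of [rep]. *)
Let rep (x : X) : X := xget 0 [set y | equiv x y]%classic.

Let rep_equiv x : equiv x (rep x).
Proof. by rewrite /rep; case: xgetP => // /(_ x) []; split. Qed.

Let rep_eq x y : equiv x y -> rep x = rep y.
Proof.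
move=> [xy yx]; rewrite /rep; congr xget; apply/funext=> z /=.
apply/propext; rewrite /equiv; split=> -[h1 h2].
  by split; [exact: le_trans yx h1|exact: le_trans h2 xy].
by split; [exact: le_trans xy h1|exact: le_trans h2 yx].
Qed.

Let rep_idem x : rep (rep x) = rep x.
Proof. by apply: rep_eq; case: (rep_equiv x). Qed.

Let leD x y x' y' : le x x' -> le y y' -> le (x + y) (x' + y').
Proof.
move=> xx' yy'; apply: (@le_trans (x' + y)); first exact: leD2.
by rewrite ![x' + _]addrC; exact: leD2.
Qed.

Let leN x y : le x y -> le (- y) (- x).
Proof.
move=> /(@leD2 (- x - y)).
by rewrite addrA addrN add0r [- x - y]addrC addrA addrN add0r.
Qed.

Definition antisym_sort : Type := {x : X | rep x = x}.

Definition antisym (x : X) : antisym_sort := exist _ (rep x) (rep_idem x).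

Let leS (a b : antisym_sort) := le (sval a) (sval b).

Let leS_anti a b : leS a b -> leS b a -> a = b.
Proof.
case: a b => x rx [y ry]; rewrite /leS /= => xy yx; apply: eq_exist.
by rewrite -rx -ry; apply: rep_eq.
Qed.

Let leS_trans b a c : leS a b -> leS b c -> leS a c.
Proof. exact: le_trans. Qed.

Let leS_antisymP x y : leS (antisym x) (antisym y) <-> le x y.
Proof.
have [[xr rx] [yr ry]] := (rep_equiv x, rep_equiv y).
split=> xy; first by apply: le_trans xr _; exact: le_trans xy ry.
by apply: le_trans rx _; exact: le_trans xy yr.
Qed.

Let antisymK (a : antisym_sort) : antisym (sval a) = a.
Proof. by case: a => x rx; exact: eq_exist. Qed.

Let joinS (a b : antisym_sort) := antisym (join (sval a) (sval b)).
Let meetS (a b : antisym_sort) := antisym (- join (- sval a) (- sval b)).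
Let mulS (a b : antisym_sort) := antisym (sval a + sval b).
Let oneS := antisym 0.
Let invS (a : antisym_sort) := antisym (- sval a).

Let leSUl a b : leS a (joinS a b).
Proof. by rewrite -{1}[a]antisymK; apply/leS_antisymP. Qed.

Let leSUr a b : leS b (joinS a b).
Proof. by rewrite -{1}[b]antisymK; apply/leS_antisymP. Qed.

Let leSUP a b c : leS a c -> leS b c -> leS (joinS a b) c.
Proof. by move=> ac bc; rewrite -[c]antisymK; apply/leS_antisymP; exact: leUP. Qed.

Let leSIl a b : leS (meetS a b) a.
Proof.
rewrite -{2}[a]antisymK; apply/leS_antisymP.
by rewrite -{2}[sval a]opprK; exact/leN/leUl.
Qed.

Let meetSC : commutative meetS.
Proof.
move=> a b; apply: leS_anti; apply/leS_antisymP; apply: leN;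
by apply: leUP.
Qed.

Let leSIr a b : leS (meetS a b) b.
Proof. by rewrite meetSC; exact: leSIl. Qed.

Let leSIP a b c : leS c a -> leS c b -> leS c (meetS a b).
Proof.
move=> ca cb; rewrite -[c]antisymK; apply/leS_antisymP.
by rewrite -[sval c]opprK; apply/leN/leUP; exact: leN.
Qed.

Let joinSE a b : joinS a b = b <-> leS a b.
Proof.
split=> [<-|ab]; first exact: leSUl.
by apply: leS_anti; [apply: leSUP => //; exact: lexx|exact: leSUr].
Qed.

Let joinSA : associative joinS.
Proof.
move=> a b c; apply: leS_anti.
  apply: leSUP; first exact: leS_trans (leSUl _ _) (leSUl _ _).
  apply: leSUP (leSUr _ _); exact: leS_trans (leSUr _ _) (leSUl _ _).
apply: leSUP; last exact: leS_trans (leSUr _ _) (leSUr _ _).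
apply: leSUP (leSUl _ _) _; exact: leS_trans (leSUl _ _) (leSUr _ _).
Qed.

Let joinSC : commutative joinS.
Proof. by move=> a b; apply: leS_anti; apply: leSUP. Qed.

Let meetSA : associative meetS.
Proof.
move=> a b c; apply: leS_anti.
  apply: leSIP; last exact: leS_trans (leSIr _ _) (leSIr _ _).
  apply: leSIP (leSIl _ _) _; exact: leS_trans (leSIr _ _) (leSIl _ _).
apply: leSIP; first exact: leS_trans (leSIl _ _) (leSIl _ _).
apply: leSIP (leSIr _ _); exact: leS_trans (leSIl _ _) (leSIr _ _).
Qed.

Let joinSKI a b : meetS a (joinS a b) = a.
Proof.
by apply: leS_anti; [exact: leSIl|apply: leSIP; [exact: lexx|exact: leSUl]].
Qed.

Let meetSKU a b : joinS a (meetS a b) = a.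
Proof.
by apply: leS_anti; [apply: leSUP; [exact: lexx|exact: leSIl]|exact: leSUl].
Qed.

Let antisym_eq x y : equiv x y -> antisym x = antisym y.
Proof. by move=> /rep_eq exy; exact: eq_exist. Qed.

Let antisymD x y : antisym (x + y) = mulS (antisym x) (antisym y).
Proof.
have [[xr rx] [yr ry]] := (rep_equiv x, rep_equiv y).
by apply: antisym_eq; split; exact: leD.
Qed.

Let mulSC : commutative mulS.
Proof. by move=> a b; rewrite /mulS addrC. Qed.

Let mulSA : associative mulS.
Proof.
move=> a b c; rewrite -[a]antisymK -[b]antisymK -[c]antisymK -!antisymD.
by rewrite addrA.
Qed.

Let mul1S : left_id oneS mulS.
Proof. by move=> a; rewrite -[a]antisymK -antisymD add0r. Qed.

Let mulS1 : right_id oneS mulS.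
Proof. by move=> a; rewrite mulSC mul1S. Qed.

Let mulVS : left_inverse oneS invS mulS.
Proof. by move=> a; rewrite -{2}[a]antisymK -antisymD addNr. Qed.

Let mulSV : right_inverse oneS invS mulS.
Proof. by move=> a; rewrite mulSC mulVS. Qed.

Let leM2l c a b : joinS a b = b -> joinS (mulS c a) (mulS c b) = mulS c b.
Proof. by rewrite !joinSE => ab; apply/leS_antisymP/leD. Qed.

Let leM2r c a b : joinS a b = b -> joinS (mulS a c) (mulS b c) = mulS b c.
Proof. by rewrite ![mulS _ c]mulSC; exact: leM2l. Qed.

Definition antisym_lGroup : lGroup :=
  LGroup joinSA joinSC meetSA meetSC joinSKI meetSKU mulSA mul1S mulS1
    mulVS mulSV leM2l leM2r.

Lemma antisym_abelian : lg_abelian antisym_lGroup.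
Proof. exact: mulSC. Qed.

Definition to_antisym (x : X) : lg_slMonoid antisym_lGroup := antisym x.

Lemma to_antisym0 : to_antisym 0 = slm_one.
Proof. by []. Qed.

Lemma to_antisymD x y : to_antisym (x + y) = slm_mul (to_antisym x) (to_antisym y).
Proof. exact: antisymD. Qed.

Lemma to_antisymU x y :
  to_antisym (join x y) = slm_join (to_antisym x) (to_antisym y).
Proof.
have [[xr rx] [yr ry]] := (rep_equiv x, rep_equiv y).
apply: antisym_eq; split; apply: leUP.
- exact: le_trans xr (leUl _ _).
- exact: le_trans yr (leUr _ _).
- exact: le_trans rx (leUl _ _).
- exact: le_trans ry (leUr _ _).
Qed.

Lemma to_antisym_le x y : slm_le (to_antisym x) (to_antisym y) <-> le x y.
Proof. by rewrite -leS_antisymP; exact: joinSE. Qed.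

End LatticePreorderedGroup.

(** * The product of the quotients by a family of total cones *)

Section ConeGroup.
Local Open Scope ring_scope.
Variables (H : zmodType) (I : Type) (pos : I -> set H).
Hypothesis posP : forall i, total_cone (pos i).

Definition cone_le (x y : I -> H) : Prop := forall i, pos i (y i - x i).

(** A coordinatewise maximum whose value is literally that of one argument, not just equivalent to
    it; [joins_word_embed] relies on this. *)
Definition cone_join (x y : I -> H) : I -> H :=
  fun i => if `[< pos i (y i - x i) >] then y i else x i.

Fact cone_lexx x : cone_le x x.
Proof. by move=> i; rewrite subrr; case: (posP i). Qed.

Fact cone_le_trans y x z : cone_le x y -> cone_le y z -> cone_le x z.
Proof.
move=> xy yz i; have [_ posD _] := posP i.
by have := posD _ _ (yz i) (xy i); rewrite addrA subrK.
Qed.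

Fact cone_leD2 z x y : cone_le x y -> cone_le (x + z) (y + z).
Proof.
by move=> xy i; rewrite !fctE opprD addrACA subrr addr0; exact: xy.
Qed.

Fact cone_leUl x y : cone_le x (cone_join x y).
Proof.
move=> i; rewrite /cone_join; case: asboolP => // _.
exact: (cone_lexx x).
Qed.

Fact cone_leUr x y : cone_le y (cone_join x y).
Proof.
move=> i; rewrite /cone_join; case: asboolP => [_|]; first exact: (cone_lexx y).
by have [_ _ /(_ (y i - x i))[//|]] := posP i; rewrite opprB.
Qed.

Fact cone_leUP x y z : cone_le x z -> cone_le y z -> cone_le (cone_join x y) z.
Proof. by move=> xz yz i; rewrite /cone_join; case: asboolP. Qed.

(* The product over i of the totally ordered groups H / (pos i :&: - pos i). *)
Definition cone_lGroup : lGroup :=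
  antisym_lGroup cone_lexx cone_le_trans cone_leD2 cone_leUl cone_leUr
    cone_leUP.

Lemma cone_lGroup_abelian : lg_abelian cone_lGroup.
Proof. exact: antisym_abelian. Qed.

Definition cone_embed (x : I -> H) : lg_slMonoid cone_lGroup :=
  to_antisym cone_lexx cone_le_trans cone_leD2 cone_leUl cone_leUr cone_leUP x.

End ConeGroup.

(** * Finite nonempty joins *)

(** The head [a] is kept apart because a semilattice has no empty join. *)
Fixpoint joins (Y : slMonoid) (A : Type) (F : A -> Y) (a : A) (s : seq A) : Y :=
  if s is b :: s' then F a `|` joins F b s' else F a.

Lemma joins_cat (Y : slMonoid) (A : Type) (F : A -> Y) a s b t :
  joins F a (s ++ b :: t) = joins F a s `|` joins F b t.
Proof. by elim: s a => //= c s IHs a; rewrite IHs slm_joinA. Qed.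

Lemma joins_le (Y : slMonoid) (A : eqType) (F : A -> Y) a s c :
  (forall b, b \in a :: s -> F b <= c) -> joins F a s <= c.
Proof.
elim: s a => [|b s IHs] a Fc /=; first exact/Fc/mem_head.
apply: slm_leUP; first exact/Fc/mem_head.
by apply: IHs => d ds; apply: Fc; rewrite in_cons ds orbT.
Qed.

Lemma le_joins (Y : slMonoid) (A : eqType) (F : A -> Y) a s b :
  b \in a :: s -> F b <= joins F a s.
Proof.
elim: s a => [|d s IHs] a.
  by rewrite mem_seq1 => /eqP->; exact: slm_le_refl.
rewrite in_cons => /predU1P[->|/IHs bs]; first exact: slm_leUl.
exact: slm_le_trans bs (slm_leUr _ _).
Qed.

(** By distributivity the pairwise products do. They are chosen before [Y] and [F], so one list
    serves both the joins in G and their evaluation in N. *)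
Lemma joins_mul (A : Type) (op : A -> A -> A) a s b t :
  exists c u, forall (Y : slMonoid) (F : A -> Y),
    {morph F : x y / op x y >-> x * y} ->
    joins F c u = joins F a s * joins F b t.
Proof.
have row (Y : slMonoid) (F : A -> Y) d : {morph F : x y / op x y >-> x * y} ->
    joins F (op d b) (map (op d) t) = F d * joins F b t.
  move=> FM; elim: t {s} b => [|b' t IHt] b /=; first by rewrite FM.
  by rewrite IHt FM slm_mulUr.
elim: s a => [|a' s IHs] a.
  by exists (op a b), (map (op a) t) => Y F FM; rewrite row.
have [c [u cu]] := IHs a'.
exists (op a b), (map (op a) t ++ c :: u) => Y F FM.
by rewrite joins_cat row // cu // -slm_mulUl.
Qed.

(** * Adjunctions and nuclei *)

Section NucleusOfAdjunction.
Variables (M N : slMonoid) (f : M -> N) (r : N -> M).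
Hypotheses (fU : {morph f : a b / a `|` b}) (fM : {morph f : a b / a * b}).
Hypotheses (f1 : f 1 = 1) (fr : forall a, f (r a) = a).
Hypothesis adj : forall x a, f x <= a <-> x <= r a.

Let r_mono a b : a <= b -> r a <= r b.
Proof. by move=> ab; apply/adj; rewrite fr. Qed.

Fact adj_nuc_mono a b : a <= b -> r (f a) <= r (f b).
Proof. by move=> ab; apply: r_mono; rewrite /slm_le -fU ab. Qed.

Fact adj_nuc_ext a : a <= r (f a).
Proof. by apply/adj; exact: slm_le_refl. Qed.

Fact adj_nuc_idem a : r (f (r (f a))) = r (f a).
Proof. by rewrite fr. Qed.

Fact adj_nuc_mul a b : r (f a) * r (f b) <= r (f (a * b)).
Proof. by apply/adj; rewrite !fM !fr; exact: slm_le_refl. Qed.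

Definition adj_nucleus : nucleus M :=
  @Nucleus M (fun x => r (f x)) adj_nuc_mono adj_nuc_ext adj_nuc_idem adj_nuc_mul.

(** Since [f] after [r] is the identity, [r] is a bijection of N onto the fixed points, with inverse
    [f]. *)
Lemma adj_nucleus_iso : slm_iso N (nuclear_image adj_nucleus).
Proof.
have rfix a : adj_nucleus (r a) = r a by rewrite /= fr.
exists (fun a => exist (fun x => adj_nucleus x = x) (r a) (rfix a)); split.
- exists (fun x => f (sval x)) => [a|[x gx]] /=; first exact: fr.
  exact: eq_exist.
- by move=> a b; apply: eq_exist; rewrite /= fU !fr.
- by move=> a b; apply: eq_exist; rewrite /= fM !fr.
- by apply: eq_exist; rewrite /= f1.
Qed.

End NucleusOfAdjunction.

(** * Sufficiency *)

Section Representation.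
Variable N : slMonoid.
Hypotheses (mulC : slm_commutative N) (icN : integrally_closed N).
Hypothesis sqN : square_condition N.

Let T : eqType := {classic N}.
Let ev (a : T) : N := a.
(** The free abelian group on [T] sits inside as the functions of finite support. *)
Let H : zmodType := T -> int.

Let weight (s : seq T) : H := fun a => Posz (count_mem a s).

Let weight_cat s t : weight (s ++ t) = (weight s + weight t)%R.
Proof. by apply/funext=> a; rewrite /weight count_cat PoszD. Qed.

Let weight_nil : weight [::] = 0%R.
Proof. exact/funext. Qed.

Let weight_inj s t : weight s = weight t -> perm_eq s t.
Proof.
by move=> st; apply/allP => a _; apply/eqP; have [] := congr1 (@^~ a) st.
Qed.

Let rel_ok (R : seq (seq T * T)) := forall r, r \in R -> evs ev r.1 <= ev r.2.

(* The cone of the relations u <= [v], where u is a word with value below v. *)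
Let cone : set H := fun h => exists2 R, rel_ok R &
  (h + weight (flatten (unzip1 R)))%R = weight (unzip2 R).

Let cone0 : cone 0%R.
Proof. by exists [::]; rewrite //= weight_nil addr0. Qed.

Let coneD x y : cone x -> cone y -> cone (x + y)%R.
Proof.
move=> [R okR eR] [R' okR' eR']; exists (R ++ R') => [r|].
  by rewrite mem_cat => /orP[/okR|/okR'].
rewrite /unzip1 /unzip2 !map_cat flatten_cat !weight_cat addrACA.
by rewrite [X in (X + _)%R]eR [X in (_ + X)%R]eR'.
Qed.

Let I : Type := {P : set H | total_cone P /\ forall h, cone h -> P h}.
Let pos (i : I) : set H := sval i.
Let posP (i : I) : total_cone (pos i). Proof. by case: (svalP i). Qed.

Let G : lGroup := cone_lGroup posP.

Let word (s : seq T) : lg_slMonoid G := cone_embed posP (fun=> weight s).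

Let word_cat : {morph word : s t / s ++ t >-> s * t}.
Proof. by move=> s t; rewrite /word weight_cat; exact: to_antisymD. Qed.

Let word_nil : word [::] = 1.
Proof. by rewrite /word weight_nil; exact: to_antisym0. Qed.

Let word_le s t : cone (weight t - weight s)%R -> word s <= word t.
Proof.
by move=> st; apply/to_antisym_le => i; have [_] := svalP i; exact.
Qed.

Let word_le_letter s a : evs ev s <= a -> word s <= word [:: a].
Proof.
move=> sa; apply: word_le; exists [:: (s, a)] => [r|].
  by rewrite mem_seq1 => /eqP->.
by rewrite /= cats0 subrK.
Qed.

(* The letter 1 cancels: [1 :: s] has value below 1, so s + [1] <= [1]. *)
Let word_le1 s : evs ev s <= 1 -> word s <= 1.
Proof.
move=> s1; rewrite -word_nil; apply: word_le.
exists [:: ((1 : N) :: s, 1 : N)] => [r|].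
  by rewrite mem_seq1 => /eqP-> /=; rewrite /evs big_cons slm_mul1x.
by rewrite /= cats0 weight_nil sub0r -cat1s weight_cat addrC addrK.
Qed.

Let joins_word_embed a A : exists2 x, joins word a A = cone_embed posP x &
  forall i, exists2 s, s \in a :: A & x i = weight s.
Proof.
elim: A a => [|b A IHA] a.
  by exists (fun=> weight a) => // i; exists a => //; exact: mem_head.
have [x /= -> xA] := IHA b.
exists (cone_join pos (fun=> weight a) x) => [|i].
  by rewrite [RHS]to_antisymU.
rewrite /cone_join; case: asboolP => _; last by exists a => //; exact: mem_head.
by have [s sA ->] := xA i; exists s => //; rewrite in_cons sA orbT.
Qed.

(** B consists of the sums of n words from [a :: A] minus n times [m], for n > 0. If B meets the
    cone, [evs_le_of_relations] applies. Otherwise some total cone P extends the cone and avoids B;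
    in its coordinate the join is a single word s, so weight s - weight m lies in P, although it is
    in B with n = 1. *)
Let evs_le_of_word m a A c : word m <= joins word a A ->
  (forall s, s \in a :: A -> evs ev s <= c) -> evs ev m <= c.
Proof.
move=> mA Ac.
pose B : set H := fun h => exists Ms, [/\ (0 < size Ms)%N,
  {subset Ms <= a :: A} &
  (h + weight (flatten (nseq (size Ms) m)))%R = weight (flatten Ms)].
have [[h [R okR eR] [Ms [Ms0 MsA eMs]]]|noCB] :=
    pselect (exists2 h, cone h & B h).
  apply: (evs_le_of_relations mulC sqN icN Ms0 okR) => [|s /MsA/Ac//].
  apply: weight_inj; rewrite !weight_cat -eR -eMs.
  by rewrite -addrA addrCA.
have BD x y : B x -> B y -> B (x + y)%R.
  move=> [Ms [Ms0 MsA eMs]] [Ks [Ks0 KsA eKs]]; exists (Ms ++ Ks); split.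
  - by rewrite size_cat addn_gt0 Ms0.
  - by move=> s; rewrite mem_cat => /orP[/MsA|/KsA].
  - rewrite size_cat nseqD !flatten_cat !weight_cat addrACA.
    by rewrite [X in (X + _)%R]eMs [X in (_ + X)%R]eKs.
have CB x : cone x -> ~ B x by move=> Cx Bx; apply: noCB; exists x.
have [P [totP CP PB]] := total_cone_extension cone0 coneD BD CB.
pose i : I := exist _ P (conj totP CP).
have [x xE xA] := joins_word_embed a A; have [s sA xs] := xA i.
have /to_antisym_le/(_ i) : word m <= cone_embed posP x by rewrite -xE.
rewrite xs => /PB[]; exists [:: s]; split=> //=; last by rewrite !cats0 subrK.
by move=> t; rewrite mem_seq1 => /eqP->.
Qed.

Let joins_mono a A b B : joins word a A <= joins word b B ->
  joins (evs ev) a A <= joins (evs ev) b B.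
Proof.
move=> AB; apply: joins_le => s sA; apply: (@evs_le_of_word _ b B).
  by apply: slm_le_trans AB; exact: le_joins.
by move=> t; exact: le_joins.
Qed.

Let inM (x : lg_slMonoid G) := exists p, x = joins word p.1 p.2.

Let inM1 : inM 1. Proof. by exists ([::], [::]); rewrite /= word_nil. Qed.

Let inM_mul x y : inM x -> inM y -> inM (x * y).
Proof.
move=> [[a A] ->] [[b B] ->] /=; have [c [C cE]] := joins_mul cat a A b B.
by exists (c, C); rewrite /= cE.
Qed.

Let inM_join x y : inM x -> inM y -> inM (x `|` y).
Proof.
move=> [[a A] ->] [[b B] ->] /=.
by exists (a, A ++ b :: B); rewrite /= joins_cat.
Qed.

Let M : subSlMonoid G := SubSlMonoid inM1 inM_mul inM_join.

(** Evaluates a presentation picked by choice; by [joins_mono], applied in both directions, the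
    value is the same for all presentations. *)
Let f (x : sub_slMonoid M) : N :=
  let p := sval (cid (svalP x)) in joins (evs ev) p.1 p.2.

Let fE x a A : sval x = joins word a A -> f x = joins (evs ev) a A.
Proof.
rewrite /f; case: cid => p /= -> pE.
by apply: slm_le_anti; apply: joins_mono; rewrite pE; exact: slm_le_refl.
Qed.

Let fU : {morph f : x y / x `|` y}.
Proof.
move=> [x Mx] [y My].
have [[[a A] xE] [[b B] yE]] := (Mx, My).
rewrite (@fE (exist _ x Mx) a A xE) (@fE (exist _ y My) b B yE) -joins_cat.
by apply: fE; rewrite joins_cat /= xE yE.
Qed.

Let fM : {morph f : x y / x * y}.
Proof.
move=> [x Mx] [y My].
have [[[a A] xE] [[b B] yE]] := (Mx, My).
have [c [C cE]] := joins_mul cat a A b B.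
rewrite (@fE (exist _ x Mx) a A xE) (@fE (exist _ y My) b B yE) -cE.
  by apply: fE; rewrite cE //= xE yE.
exact: evs_cat.
Qed.

Let f1 : f 1 = 1.
Proof. by rewrite (@fE _ [::] [::]) /= ?evs_nil ?word_nil. Qed.

Let r (a : N) : sub_slMonoid M :=
  exist _ (word [:: a]) (ex_intro _ ([:: a], [::]) erefl).

Let fr a : f (r a) = a.
Proof. by rewrite (@fE _ [:: a] [::]) //= evs1. Qed.

(** If the value of x is below a, so is that of each of its words, and the cone contains the
    relation putting such a word below the letter a. The converse is [joins_mono]. *)
Let adj x a : f x <= a <-> x <= r a.
Proof.
case: x => x Mx; have [[b B] xE] := Mx.
split=> [fa|/sub_slMonoid_le /= xa].
  apply/sub_slMonoid_le; rewrite /= xE; apply: joins_le => s sB.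
  apply: word_le_letter; apply: slm_le_trans fa.
  by rewrite (@fE (exist _ x Mx) b B xE); exact: le_joins.
rewrite (@fE (exist _ x Mx) b B xE) -[a]fr (@fE (r a) [:: a] [::]) //.
by apply: joins_mono; rewrite -xE.
Qed.

Lemma nuclear_representation :
  exists (G : lGroup) (M : subSlMonoid G) (g : nucleus (sub_slMonoid M)),
    [/\ lg_abelian G, slm_iso N (nuclear_image g) & integral N -> sub_integral M].
Proof.
exists G, M, (adj_nucleus fU fM fr adj); split.
- exact: cone_lGroup_abelian.
- exact: adj_nucleus_iso.
(* When N is integral every word has value below 1, hence lies below 1 in G, and so do joins of
   words. *)
- move=> N1 _ [[a A] ->]; apply: joins_le => s _.
  exact/word_le1/N1.
Qed.

End Representation.

Lemma integral_integrally_closed (N : slMonoid) : integral N -> integrally_closed N.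
Proof. by move=> N1; split=> a x _; exact: N1. Qed.

Theorem theoremC (N : slMonoid) :
  ((slm_commutative N /\ integrally_closed N /\ square_condition N) <->
   (exists (G : lGroup) (M : subSlMonoid G) (g : nucleus (sub_slMonoid M)),
      lg_abelian G /\ slm_iso N (nuclear_image g)))
  /\
  ((slm_commutative N /\ integral N /\ square_condition N) <->
   (exists (G : lGroup) (M : subSlMonoid G) (g : nucleus (sub_slMonoid M)),
      lg_abelian G /\ sub_integral M /\ slm_iso N (nuclear_image g))).
Proof.
split; split.
- move=> [mulC [icN sqN]].
  have [G [M [g [abG isoN _]]]] := nuclear_representation mulC icN sqN.
  by exists G, M, g.
- move=> [G [M [g [abG [f [fbij fU fM f1]]]]]].
  have [mulC sqN] := nuclear_image_commutative_square fbij fU fM f1 abG.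
  by split=> //; split=> //; exact: nuclear_image_integrally_closed fbij fU fM f1.
- move=> [mulC [N1 sqN]].
  have [G [M [g [abG isoN M1]]]] :=
    nuclear_representation mulC (integral_integrally_closed N1) sqN.
  by exists G, M, g; split=> //; split=> //; exact: M1.
- move=> [G [M [g [abG [M1 [f [fbij fU fM f1]]]]]]].
  have [mulC sqN] := nuclear_image_commutative_square fbij fU fM f1 abG.
  by split=> //; split=> //; exact: nuclear_image_integral fbij fU f1 M1.
Qed.
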